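(* For every integer $n\ge 6$, the maximum of the syntactic complexity $\sigma(L)$ over all regular suffix-free languages $L$ (over arbitrary finite alphabets) having exactly $n$ distinct left quotients is $(n-1)^{n-2}+n-2$.
   Context: Let $\Sigma$ be a finite nonempty alphabet. A language $L\subseteq\Sigma^*$ is suffix-free if whenever $w\in L$ and $u\in L$ with $u$ a suffix of $w$ (i.e. $w=vu$ for some $v\in\Sigma^*$), then $u=w$. For $w\in\Sigma^*$ the left quotient of $L$ by $w$ is $L.w=\{x\in\Sigma^*\mid wx\in L\}$; the number of distinct left quotients of a regular language equals the number of states of its minimal complete DFA. The syntactic complexity $\sigma(L)$ of a regular language $L$ is the cardinality of its syntactic semigroup, equivalently the cardinality of the transition semigroup of its minimal complete DFA, i.e. the semigroup of transformations of the state set induced by nonempty words. *)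

(* Defs.v *)
From mathcomp Require Import all_boot.
Set Implicit Arguments. Unset Strict Implicit. Unset Printing Implicit Defensive.

Definition nclasses (T : Type) (P : T -> Prop) (R : T -> T -> Prop) (k : nat) :=
  exists f : 'I_k -> T,
    (forall i, P (f i)) /\
    (forall i j, R (f i) (f j) -> i = j) /\
    (forall x, P x -> exists i, R x (f i)).

Definition suffix_free (S : Type) (L : seq S -> Prop) :=
  forall v u : seq S, L (v ++ u) -> L u -> v = [::].

Definition same_quotient (S : Type) (L : seq S -> Prop) (u v : seq S) :=
  forall x, L (u ++ x) <-> L (v ++ x).

Definition num_quotients (S : Type) (L : seq S -> Prop) (n : nat) :=
  nclasses (fun _ => True) (same_quotient L) n.

(* syntactic congruence: u ~ v iff for all x y, x u y in L <-> x v y in L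
   (equivalently u and v induce the same transformation on the quotients) *)
Definition synt_equiv (S : Type) (L : seq S -> Prop) (u v : seq S) :=
  forall x y, L (x ++ u ++ y) <-> L (x ++ v ++ y).

(* sigma(L) = k : the syntactic semigroup (classes of nonempty words) has k elements *)
Definition syntactic_complexity (S : Type) (L : seq S -> Prop) (k : nat) :=
  nclasses (fun w : seq S => w <> [::]) (synt_equiv L) k.

(* Main.v *)
Require Import Defs.
From mathcomp Require Import all_boot zify.
From Stdlib Require Import ClassicalEpsilon.
Set Implicit Arguments.
Unset Strict Implicit.
Unset Printing Implicit Defensive.

(* In the minimal automaton of L let V be the set of the m = n - 2 states that
   are neither initial nor the sink.  A nonempty word w acts as a partial map on
   V together with the state 0w.  Suffix-freeness says: if 0w = p and rw = q with
   p, q, r in V, then no word sends p and q to the same state of V.  Let e be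
   the graph of all such pairs p, q.  Every action is then a partial coloring of
   V by V that is proper for e, and it takes its values in the neighborhood N(a)
   when 0w = a.  So it suffices to prove
     #proper + sum_a #(proper into N(a)) <= (m+1)^m + m.

   For a vertex a, let K_a count the improper maps that become proper when a is
   uncolored, and M_a those among them in which a agrees with two neighbors.  An
   improper map is counted at most twice by the K_a and M_a together, hence it is
   enough that 2 #(proper into N(a)) <= K_a + M_a + 2 for every a.  All these
   numbers are compared through one recursion, which uncolors a single vertex.
   It reduces the inequality to arithmetic unless a is adjacent to all other
   vertices and m <= 5, or m = 4 and a has degree 2; these few cases are counted.

   The bound is attained by the automaton whose letters are all the maps fixing
   the sink that either send the initial state to the sink, or send it into V
   and V to the sink: these maps are closed under composition. *)

(** * Partial proper colorings and the recursion that uncolors one vertex *)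

Section PartialColorings.
Variables (V : finType) (e : rel V).
Hypotheses (e_sym : symmetric e) (e_irr : irreflexive e).
Implicit Types (p q : {ffun V -> option V}) (A D : {set V}) (u v c : V).

Definition proper_coloring p :=
  [forall u, forall v, forall c, ~~ [&& e u v, p u == Some c & p v == Some c]].

(** Colors are vertices, since the maps act on [V]. The set [A] of vertices kept blank grows along
    the recursion; the palette [D] is later all of [V], a neighborhood, or some set of prescribed
    size. *)
Definition colorings A D : {set {ffun V -> option V}} :=
  [set p | [&& proper_coloring p, [forall u in A, p u == None]
             & [forall u, forall c, (p u == Some c) ==> (c \in D)]]].

Definition recolor p u o : {ffun V -> option V} :=
  [ffun v => if v == u then o else p v].

Definition color_class p c := [set v | p v == Some c].
Definition free p u c := [forall v, e u v ==> (p v != Some c)].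
Definition unused D p := #|[set c in D | color_class p c == set0]|.
Definition blocked D p u := #|[set c in D | ~~ free p u c]|.
Definition unique_at p u := [exists c, color_class p c == [set u]].
Definition pair_at p u v :=
  (u != v) && [exists c, color_class p c == [set u; v]].

Lemma proper_coloringP p :
  reflect (forall u v c, e u v -> p u = Some c -> p v <> Some c) (proper_coloring p).
Proof.
apply: (iffP idP) => [pp u v c euv pu pv|h].
  move/forallP/(_ u)/forallP/(_ v)/forallP/(_ c): pp.
  by rewrite euv pu pv eqxx.
apply/forallP => u; apply/forallP => v; apply/forallP => c.
by apply/negP => /and3P [euv /eqP pu /eqP pv]; exact: (h u v c).
Qed.

Lemma coloringsP A D p :
  reflect [/\ forall u v c, e u v -> p u = Some c -> p v <> Some c,
              forall u, u \in A -> p u = None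
            & forall u c, p u = Some c -> c \in D] (p \in colorings A D).
Proof.
rewrite inE; apply: (iffP and3P) => [[h1 h2 h3]|[h1 h2 h3]]; split.
- exact/proper_coloringP.
- by move=> u uA; apply/eqP; move/forallP/(_ u)/implyP: h2; apply.
- move=> u c pu; move/forallP/(_ u)/forallP/(_ c)/implyP: h3; apply.
  exact/eqP.
- exact/proper_coloringP.
- by apply/forallP => u; apply/implyP => /h2 ->.
- by apply/forallP => u; apply/forallP => c; apply/implyP => /eqP /h3.
Qed.

Lemma freeP p u c : reflect (forall v, e u v -> p v <> Some c) (free p u c).
Proof.
apply: (iffP forallP) => h v; first by move=> euv; apply/eqP; exact: (implyP (h v)).
by apply/implyP => /h /eqP.
Qed.

Lemma class0P p c : reflect (forall v, p v <> Some c) (color_class p c == set0).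
Proof.
apply: (iffP eqP) => [h v pv|h].
  by have := in_set0 v; rewrite -h inE pv eqxx.
by apply/setP => v; rewrite !inE; apply/eqP/h.
Qed.

Lemma recolor_same p u o : recolor p u o u = o.
Proof. by rewrite ffunE eqxx. Qed.

Lemma recolor_other p u o v : v != u -> recolor p u o v = p v.
Proof. by rewrite ffunE => /negPf ->. Qed.

Lemma recolorK p u o : p u = None -> recolor (recolor p u o) u None = p.
Proof. by move=> pu; apply/ffunP => v; rewrite !ffunE; case: eqP => // ->. Qed.

Lemma recolor_id p u : recolor p u (p u) = p.
Proof. by apply/ffunP => v; rewrite ffunE; case: eqP => // ->. Qed.

Lemma recolor_recolor p u o o' : recolor (recolor p u o) u o' = recolor p u o'.
Proof. by apply/ffunP => v; rewrite !ffunE; case: eqP. Qed.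

Lemma uncolor_in A D p u :
  p \in colorings A D -> recolor p u None \in colorings (u |: A) D.
Proof.
move/coloringsP => [h1 h2 h3]; apply/coloringsP; split.
- move=> v w c evw; rewrite !ffunE; case: eqP => // _; case: eqP => // _.
  exact: h1.
- move=> v; rewrite in_setU1 ffunE; case: eqP => //= _; exact: h2.
- move=> v c; rewrite ffunE; case: eqP => // _; exact: h3.
Qed.

Lemma blank_sub A D p u : p \in colorings (u |: A) D -> p \in colorings A D.
Proof.
move/coloringsP => [h1 h2 h3]; apply/coloringsP; split=> // v vA.
by apply: h2; rewrite in_setU1 vA orbT.
Qed.

Lemma blank_at A D p u : p \in colorings (u |: A) D -> p u = None.
Proof. by case/coloringsP => _ h _; apply: h; rewrite setU11. Qed.

Lemma recolor_in A D p u c : u \notin A -> p \in colorings (u |: A) D ->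
  (recolor p u (Some c) \in colorings A D) = (c \in D) && free p u c.
Proof.
move=> uA pX; have pu := blank_at pX; case/coloringsP: pX => h1 h2 h3.
apply/coloringsP/andP => [[g1 g2 g3]|[cD /freeP fc]].
  split; first by apply: (g3 u); rewrite recolor_same.
  apply/freeP => v euv pv.
  have vu : v != u by apply/eqP => vu; rewrite vu pu in pv.
  by apply: (g1 u v c euv); rewrite ?recolor_same ?recolor_other.
split.
- move=> v w c'; rewrite !ffunE.
  case: (eqVneq v u) => [->|vu]; case: (eqVneq w u) => [->|wu].
  + by rewrite e_irr.
  + by move=> euw [<-]; apply: fc.
  + by rewrite e_sym => euv pv [cc]; apply: (fc v euv); rewrite cc.
  + exact: h1.
- move=> v vA; rewrite recolor_other; last by apply: contraNneq uA => <-.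
  by apply: h2; rewrite in_setU1 vA orbT.
- move=> v c'; rewrite ffunE; case: eqP => [_ [<-] //|_]; exact: h3.
Qed.

(* Every coloring is obtained in exactly one way from a coloring that leaves
   [u] blank, by giving [u] either no color or a color that is free at [u]. *)
Lemma sum_colorings_at A D u (psi : {ffun V -> option V} -> nat) : u \notin A ->
  \sum_(p in colorings A D) psi p =
  \sum_(p in colorings (u |: A) D)
     (psi p + \sum_(c in D | free p u c) psi (recolor p u (Some c))).
Proof.
move=> uA.
rewrite (partition_big (fun p => recolor p u None)
           (mem (colorings (u |: A) D))) /=; last by move=> p; apply: uncolor_in.
apply: eq_bigr => q qX; have qu := blank_at qX.
rewrite (reindex_onto (fun o => recolor q u o) (fun p => p u)) /=; last first.
  by move=> p /andP [_ /eqP <-]; rewrite recolor_recolor recolor_id.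
have E o : [&& recolor q u o \in colorings A D,
               recolor (recolor q u o) u None == q & recolor q u o u == o] =
           (if o is Some c then (c \in D) && free q u c else true).
  rewrite recolor_same eqxx andbT recolorK // eqxx andbT.
  case: o => [c|]; first exact: recolor_in.
  by rewrite -[None]qu recolor_id (blank_sub qX).
under eq_bigl => o do rewrite -andbA E.
rewrite (bigD1 None) //= -{1}qu recolor_id; congr (_ + _).
rewrite (reindex_onto Some (fun o => odflt u o)) /=; last by case.
by apply: eq_bigl => c; rewrite eqxx !andbT.
Qed.

Lemma free_blocked D p u : (\sum_(c in D | free p u c) 1) + blocked D p u = #|D|.
Proof.
rewrite -(cardsID [set c | free p u c] D); congr (_ + _).
  by rewrite sum1dep_card; apply: eq_card => c; rewrite !inE.
by apply: eq_card => c; rewrite !inE andbC.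
Qed.

(** A coloring [p] blank at [u] extends in [1 + #|D| - blocked D p u] ways; sum this over [p]. *)
Lemma card_colorings_at A D u : u \notin A ->
  #|colorings A D| + \sum_(p in colorings (u |: A) D) blocked D p u
  = #|D|.+1 * #|colorings (u |: A) D|.
Proof.
move=> uA; rewrite -sum1_card (sum_colorings_at _ _ uA) -big_split /=.
rewrite mulnC -sum_nat_const; apply: eq_bigr => p _.
by rewrite -addnA free_blocked.
Qed.

Lemma card_colorings_leq A D u : u \notin A ->
  #|colorings A D| <= #|D|.+1 * #|colorings (u |: A) D|.
Proof. by move=> uA; rewrite -card_colorings_at // leq_addr. Qed.

(** * Colors that occur on no vertex, on one vertex, or on exactly two *)

Lemma recolor_class A D p u c c' : p \in colorings (u |: A) D ->
  color_class (recolor p u (Some c)) c' =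
  if c' == c then u |: color_class p c else color_class p c'.
Proof.
move=> /blank_at pu; apply/setP => v; rewrite inE ffunE.
case: (eqVneq c' c) => [->|cc]; case: (eqVneq v u) => [->|vu].
- by rewrite setU11 eqxx.
- by rewrite in_setU1 (negPf vu) inE.
- by rewrite inE pu /=; apply/eqP => [[]] /esym /eqP; rewrite (negPf cc).
- by rewrite inE.
Qed.

Lemma eq_set1 u v : ([set u] == [set v]) = (u == v).
Proof. by apply/eqP/eqP => [/set1_inj|->]. Qed.

Lemma class_disjoint p c c' v :
  v \in color_class p c -> v \in color_class p c' -> c = c'.
Proof. by rewrite !inE => /eqP -> /eqP []. Qed.

Lemma sum_unique_at A D u : u \notin A ->
  \sum_(p in colorings A D) unique_at p u
  = \sum_(p in colorings (u |: A) D) unused D p.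
Proof.
move=> uA; rewrite (sum_colorings_at _ _ uA); apply: eq_bigr => p pX.
have pu := blank_at pX.
have -> : unique_at p u = false.
  apply/existsP => [[c /eqP cu]].
  by have := set11 u; rewrite -cu inE pu.
rewrite add0n /unused -sum1dep_card big_mkcondr [RHS]big_mkcondr /=.
apply: eq_bigr => c cD.
have -> : unique_at (recolor p u (Some c)) u = (color_class p c == set0).
  apply/existsP/class0P => [[c']|h].
    rewrite (recolor_class _ _ pX); case: (eqVneq c' c) => [_ /eqP cu v pv|_ /eqP cu].
      have : v \in u |: color_class p c by rewrite !inE pv eqxx orbT.
      by rewrite cu inE => /eqP vu; rewrite vu pu in pv.
    by have := set11 u; rewrite -cu inE pu.
  exists c; rewrite (recolor_class _ _ pX) eqxx; apply/eqP/setP => v.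
  by rewrite !inE orbC; case: eqP => [/h|].
by case: (boolP (free p u c)) => [_|/freeP nf]; case: class0P => // h; case: nf => v _.
Qed.

Lemma unused_recolor A D p u c : p \in colorings (u |: A) D -> c \in D ->
  unused D (recolor p u (Some c)) + (color_class p c == set0) = unused D p.
Proof.
move=> pX cD; rewrite /unused addnC.
rewrite -(cardsID [set c] [set c0 in D | color_class p c0 == set0]).
congr (_ + _).
  case: (boolP (color_class p c == set0)) => h.
    rewrite -[nat_of_bool true](cards1 c); apply: eq_card => c'; rewrite !inE.
    by case: eqP => [->|]; rewrite ?andbT ?andbF // cD h.
  apply/esym/eqP; rewrite cards_eq0; apply/eqP/setP => c'; rewrite !inE.
  by case: (eqVneq c' c) => [->|]; rewrite ?(negPf h) ?andbF.
apply: eq_card => c'; rewrite !inE (recolor_class _ _ pX).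
case: (eqVneq c' c) => [->|] //=.
by apply/andP => [[_ /eqP /setP /(_ u)]]; rewrite !inE eqxx.
Qed.

Lemma sum_unused_leq A D u : u \notin A ->
  \sum_(p in colorings A D) unused D p
  <= #|D| * \sum_(p in colorings (u |: A) D) unused D p.
Proof.
move=> uA; rewrite (sum_colorings_at _ _ uA) big_distrr /=.
apply: leq_sum => p pX.
have le1 : \sum_(c in D | free p u c) unused D (recolor p u (Some c))
    <= \sum_(c in D) (unused D p - (color_class p c == set0)).
  rewrite big_mkcondr /=; apply: leq_sum => c cD; case: ifP => // _.
  by rewrite -(unused_recolor pX cD) addnK.
have eq2 : \sum_(c in D) (color_class p c == set0) = unused D p.
  by rewrite /unused -sum1dep_card big_mkcondr /=.
have [y0|y0] := posnP (unused D p).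
  apply: (leq_trans (leq_add (leqnn _) le1)); rewrite y0 add0n muln0.
  by rewrite big1 // => c _; rewrite sub0n.
have eq3 : \sum_(c in D) (unused D p - (color_class p c == set0)) + unused D p
    = #|D| * unused D p.
  rewrite -{2}eq2 -big_split /= -sum_nat_const; apply: eq_bigr => c _.
  by rewrite subnK //; case: (_ == _) => //; exact: y0.
by rewrite -eq3 addnC leq_add2r.
Qed.

(** If [v] is alone in its class, its color is free at the non-neighbor [u], and giving it to [u]
    creates the class [[set u; v]]. *)
Lemma sum_pair_at A D u v : u \notin A -> v \notin A -> u != v -> ~~ e u v ->
  \sum_(p in colorings (v |: (u |: A)) D) unused D p
  <= \sum_(p in colorings A D) pair_at p u v.
Proof.
move=> uA vA uv nuv.
rewrite -sum_unique_at; last by rewrite in_setU1 negb_or eq_sym uv.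
rewrite (sum_colorings_at _ _ uA); apply: leq_sum => p pX.
case: (boolP (unique_at p v)) => // /existsP [c /eqP cv].
have pv : p v = Some c by have := set11 v; rewrite -cv inE => /eqP.
have cD : c \in D by case/coloringsP: pX => _ _ h; exact: (h v).
have fc : free p u c.
  apply/freeP => w euw pw.
  have : w \in [set v] by rewrite -cv inE pw.
  by rewrite inE => /eqP wv; rewrite -wv euw in nuv.
apply: leq_trans (leq_addl _ _).
rewrite (bigD1 c) /=; last by rewrite cD fc.
apply: leq_trans (leq_addr _ _).
rewrite /pair_at uv /= lt0b; apply/existsP; exists c.
by rewrite (recolor_class _ _ pX) eqxx cv.
Qed.

(** Only classes of size 1 or 2 contribute: a singleton counts once, with weight 2, and a pair
    counts for its two orderings. *)
Lemma classes_at_color p c :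
  2 * (\sum_u (color_class p c == [set u]))
  + \sum_u \sum_v ((u != v) && (color_class p c == [set u; v]))
  <= 2 * (color_class p c != set0)
  /\ \sum_u \sum_v ((u != v) && (color_class p c == [set u; v]))
  <= 2 * (1 < #|color_class p c|).
Proof.
set P := color_class p c.
have s1 : \sum_u (P == [set u]) = (#|P| == 1).
  case: (boolP (#|P| == 1)) => [/cards1P [w ->]|h].
    rewrite (bigD1 w) //= eqxx big1 // => u uw.
    by rewrite eq_set1 eq_sym (negPf uw).
  by rewrite big1 // => u _; case: eqP => // Pu; rewrite Pu cards1 in h.
have s2 : \sum_u \sum_v ((u != v) && (P == [set u; v])) <= 2 * (#|P| == 2).
  case: (boolP (#|P| == 2)) => [/cards2P [a [b [ab ->]]]|h]; last first.
    rewrite big1 // => u _; rewrite big1 // => v _.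
    by case: eqVneq => //= uv; case: eqP => // Pu; rewrite Pu cards2 uv in h.
  rewrite pair_big /=.
  rewrite (eq_bigr (fun i : V * V =>
    if i \in [set (a, b); (b, a)] then 1 else 0)); last first.
    case=> u v _ /=; rewrite !inE !xpair_eqE.
    case: (eqVneq u v) => [->|uv] /=.
      case: (eqVneq v a) => [->|] //=; rewrite ?(negPf ab) ?andbF //.
    case: eqP => [h|h].
      have := set21 u v; have := set22 u v; rewrite -h !inE => /orP hv /orP hu.
      by case: hv hu uv => /eqP -> [] /eqP ->; rewrite ?eqxx ?orbT.
    case: ifP => // /orP [] /andP [/eqP hu /eqP hv]; case: h; rewrite hu hv //.
    by rewrite setUC.
  by rewrite -big_mkcond /= sum1_card cards2; case: (_ == _).
have P0 : (P != set0) = (0 < #|P|) by rewrite card_gt0.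
rewrite s1 P0; split; last first.
  by apply: leq_trans s2 _; case: #|P| => [|[|[|k]]].
by apply: leq_trans (leq_add (leqnn _) s2) _; case: #|P| => [|[|[|k]]].
Qed.

Lemma unique_at_sum p u : unique_at p u = \sum_c (color_class p c == [set u]) :> nat.
Proof.
case: (boolP (unique_at p u)) => [/existsP [c cu]|h]; last first.
  rewrite big1 // => c _; case: (boolP (_ == _)) => // cu.
  by case/existsP: h; exists c.
rewrite (bigD1 c) //= cu big1 // => c' cc; case: eqP => // cu'.
move/eqP: cu => cu; case/eqP: cc; apply: (@class_disjoint p c' c u).
  by rewrite cu' set11.
by rewrite cu set11.
Qed.

Lemma pair_at_sum p u v :
  pair_at p u v = \sum_c ((u != v) && (color_class p c == [set u; v])) :> nat.
Proof.
rewrite /pair_at; case: (u != v) => /=; last by rewrite big1.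
case: (boolP [exists c, _]) => [/existsP [c cu]|h]; last first.
  rewrite big1 // => c _; case: (boolP (_ == _)) => // cu.
  by case/existsP: h; exists c.
rewrite (bigD1 c) //= cu big1 // => c' cc; case: eqP => // cu'.
move/eqP: cu => cu; case/eqP: cc; apply: (@class_disjoint p c' c u).
  by rewrite cu' set21.
by rewrite cu set21.
Qed.

Lemma sum_pair_at_color p :
  \sum_u \sum_v pair_at p u v =
  \sum_c \sum_u \sum_v ((u != v) && (color_class p c == [set u; v])).
Proof.
rewrite exchange_big /=; apply/esym.
rewrite exchange_big /= [RHS]exchange_big; apply: eq_bigr => u _.
by rewrite exchange_big /=; apply: eq_bigr => v _; rewrite pair_at_sum.
Qed.

Lemma used_lower_bound p :
  2 * \sum_u unique_at p u + \sum_u \sum_v pair_at p u v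
  <= 2 * #|[set c | color_class p c != set0]|.
Proof.
under eq_bigr => u _ do rewrite unique_at_sum.
rewrite exchange_big /= sum_pair_at_color big_distrr /= -big_split /=.
rewrite -sum1dep_card [X in _ <= 2 * X]big_mkcond [X in _ <= X]big_distrr /=.
apply: leq_sum => c _.
have [h _] := classes_at_color p c; apply: leq_trans h _.
by case: (_ != _).
Qed.

Lemma repeated_lower_bound p :
  \sum_u \sum_v pair_at p u v <= 2 * #|[set c | 1 < #|color_class p c|]|.
Proof.
rewrite sum_pair_at_color -sum1dep_card [X in _ <= 2 * X]big_mkcond.
rewrite [X in _ <= X]big_distrr /=.
apply: leq_sum => c _.
have [_ h] := classes_at_color p c; apply: leq_trans h _.
by case: (_ < _).
Qed.

Lemma used_unused A D p : p \in colorings A D ->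
  #|[set c | color_class p c != set0]| + unused D p = #|D|.
Proof.
case/coloringsP => _ _ h.
rewrite -(cardsID [set c | color_class p c != set0] D); congr (_ + _).
  apply: eq_card => c; rewrite !inE andbC; case: eqVneq => //= /set0Pn [v].
  by rewrite inE => /eqP /h ->.
by apply: eq_card => c; rewrite !inE negbK andbC.
Qed.

(** Neighbors of [u] that are alone in their classes block pairwise different colors. *)
Lemma blocked_lower_bound A D p u : p \in colorings A D ->
  \sum_(v | e u v) unique_at p v <= blocked D p u.
Proof.
case/coloringsP => _ _ hD.
under eq_bigr => v _ do rewrite unique_at_sum.
rewrite exchange_big /= /blocked -sum1dep_card [X in _ <= X]big_mkcond /=.
apply: leq_sum => c _.
case: (boolP [exists v, e u v && (color_class p c == [set v])]); last first.
  move=> h; rewrite big1 // => v euv; case: (boolP (_ == _)) => // cv.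
  by case/existsP: h; exists v; rewrite euv.
case/existsP => v /andP [euv /eqP cv].
have pv : p v = Some c by have := set11 v; rewrite -cv inE => /eqP.
rewrite (hD v c pv) /= ifT; last by apply/freeP => /(_ v euv).
rewrite (bigD1 v) //= cv eqxx big1 // => w /andP [_ wv].
by rewrite eq_set1 eq_sym (negPf wv).
Qed.

(** * Dependence on the number of colors *)

Lemma sum_unused A D :
  \sum_(p in colorings A D) unused D p = \sum_(c in D) #|colorings A (D :\ c)|.
Proof.
have -> : \sum_(p in colorings A D) unused D p =
  \sum_(p in colorings A D) \sum_(c in D) (color_class p c == set0).
  by apply: eq_bigr => p _; rewrite /unused -sum1dep_card big_mkcondr.
rewrite exchange_big /=; apply: eq_bigr => c cD.
rewrite -sum1_card [RHS](eq_bigl (fun p =>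
   (p \in colorings A D) && (color_class p c == set0))); last first.
  move=> p; apply/coloringsP/andP => [[h1 h2 h3]|[/coloringsP [h1 h2 h3] /class0P h4]].
    split.
      by apply/coloringsP; split=> // v c' /h3; rewrite in_setD1 => /andP [].
    by apply/class0P => v /h3; rewrite setD11.
  split=> // v c' pv; rewrite in_setD1 (h3 _ _ pv) andbT.
  by apply/eqP => cc; apply: (h4 v); rewrite -cc.
by rewrite big_mkcondr.
Qed.

(** Renaming the colors by an injection [h] from [D] into [D'] preserves properness. *)
Lemma card_colorings_mono A D D' : #|D| <= #|D'| ->
  #|colorings A D| <= #|colorings A D'|.
Proof.
(* The ranking of [D] used for [h] requires some element [c0] of [D], so the empty palette is
   treated apart. *)
move=> le; case: (set_0Vmem D) => [D0|[c0 c0D]].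
  apply: subset_leq_card; apply/subsetP => p /coloringsP [h1 h2 h3].
  by apply/coloringsP; split=> // u c /h3; rewrite D0 inE.
pose h c := enum_val (widen_ord le (enum_rank_in c0D c)).
have hD' c : h c \in D' by exact: enum_valP.
have hI : {in D &, injective h}.
  move=> c c' cD c'D /enum_val_inj /(congr1 val) /= /val_inj.
  exact: (can_in_inj (enum_rankK_in c0D)).
pose H p : {ffun V -> option V} := [ffun u => omap h (p u)].
have HE p u c : p \in colorings A D -> c \in D ->
    (H p u = Some (h c)) -> p u = Some c.
  case/coloringsP => _ _ h3 cD; rewrite ffunE.
  case pu: (p u) => [c'|] //= [/hI]-> //; exact: (h3 u).
have HI : {in colorings A D &, injective H}.
  move=> p q pX qX pq; apply/ffunP => u; apply/esym.
  case pu: (p u) => [c|].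
    apply: (HE q) => //; last by rewrite -pq ffunE pu.
    by case/coloringsP: pX => _ _ h3; exact: (h3 u).
  by move/ffunP/(_ u): pq; rewrite !ffunE pu; case: (q u).
rewrite -(card_in_imset HI); apply: subset_leq_card.
apply/subsetP => _ /imsetP [p pX ->].
have [h1 h2 h3] := coloringsP _ _ _ pX.
apply/coloringsP; split.
- move=> u v c euv; rewrite ffunE; case pu: (p u) => [c'|] //= [<-].
  by move/(HE _ _ _ pX (h3 _ _ pu)); apply: h1 euv pu.
- by move=> u /h2; rewrite ffunE => ->.
- by move=> u c; rewrite ffunE; case: (p u) => //= c' [<-].
Qed.

Lemma card_colorings_eq A D D' : #|D| = #|D'| ->
  #|colorings A D| = #|colorings A D'|.
Proof. by move=> DD; apply/eqP; rewrite eqn_leq !card_colorings_mono ?DD. Qed.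

Lemma sum_unused_card A D D' : #|D| = #|D'|.+1 ->
  \sum_(p in colorings A D) unused D p = #|D| * #|colorings A D'|.
Proof.
move=> DD; rewrite sum_unused -sum_nat_const; apply: eq_bigr => c cD.
by apply: card_colorings_eq; move: (cardsD1 c D); rewrite cD DD => - [].
Qed.

Definition used p := #|[set c | color_class p c != set0]|.

Lemma sum_pairs_lower_bound A D :
  \sum_(u | u \notin A) \sum_(v | [&& v \notin A, u != v & ~~ e u v])
     \sum_(p in colorings (v |: (u |: A)) D) unused D p
  <= \sum_(p in colorings A D) \sum_u \sum_v pair_at p u v.
Proof.
rewrite exchange_big /= big_mkcond /=; apply: leq_sum => u _.
case: ifP => // uA; rewrite exchange_big /= big_mkcond /=.
apply: leq_sum => v _; case: ifP => // /and3P [vA uv nuv].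
exact: sum_pair_at.
Qed.

Lemma sum_used_lower_bound A D :
  2 * (\sum_(u | u \notin A) \sum_(p in colorings (u |: A) D) unused D p)
  + \sum_(u | u \notin A) \sum_(v | [&& v \notin A, u != v & ~~ e u v])
       \sum_(p in colorings (v |: (u |: A)) D) unused D p
  <= 2 * \sum_(p in colorings A D) used p.
Proof.
have h1 : \sum_(u | u \notin A) \sum_(p in colorings (u |: A) D) unused D p
    <= \sum_(p in colorings A D) \sum_u unique_at p u.
  rewrite exchange_big /= big_mkcond /=; apply: leq_sum => u _.
  by case: ifP => // uA; rewrite sum_unique_at.
apply: leq_trans (leq_add (leq_mul (leqnn 2) h1) (sum_pairs_lower_bound A D)) _.
rewrite !big_distrr /= -big_split /=; apply: leq_sum => p _.
exact: used_lower_bound.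
Qed.

Lemma sum_used_unused A D :
  \sum_(p in colorings A D) used p + \sum_(p in colorings A D) unused D p
  = #|D| * #|colorings A D|.
Proof.
rewrite -big_split /= mulnC -sum_nat_const; apply: eq_bigr => p pX.
exact: used_unused pX.
Qed.

Lemma card_add_color A D D' : #|D'| = #|D|.+1 ->
  #|colorings A D| + \sum_(u | u \notin A) #|colorings (u |: A) D|
  <= #|colorings A D'|.
Proof.
move=> DD; rewrite -(leq_pmul2l (m := #|D'|)) ?DD // -DD -sum_used_unused.
rewrite mulnDr -(sum_unused_card A DD) addnC leq_add2r -(leq_pmul2l (m := 2)) //.
apply: leq_trans (sum_used_lower_bound A D').
apply: leq_trans (leq_addr _ _); rewrite leq_pmul2l // big_distrr /=.
by apply: leq_sum => u uA; rewrite (sum_unused_card _ DD).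
Qed.

(** In [card_add_color] each of the at least [#|D|.+1] summands is at least [#|colorings A D|]
    divided by [#|D|.+1]. *)
Lemma card_double A D D' : #|D'| = #|D|.+1 -> #|D| < #|~: A| ->
  2 * #|colorings A D| <= #|colorings A D'|.
Proof.
move=> DD DA; apply: leq_trans (card_add_color A DD).
rewrite mul2n -addnn leq_add2l.
rewrite -(leq_pmul2l (m := #|D|.+1)) // big_distrr /=.
have : \sum_(u | u \notin A) #|colorings A D| <=
       \sum_(u | u \notin A) #|D|.+1 * #|colorings (u |: A) D|.
  by apply: leq_sum => u uA; exact: card_colorings_leq.
apply: leq_trans.
have -> : \sum_(u | u \notin A) #|colorings A D| = #|~: A| * #|colorings A D|.
  by rewrite -sum_nat_const; apply: eq_bigl => u; rewrite inE.
by rewrite leq_mul2r DA orbT.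
Qed.

(** * Collisions at a vertex against colorings into its neighborhood *)

Definition nbrs a := [set v | e a v].

Definition repeated p a := #|[set c | 1 < #|nbrs a :&: color_class p c|]|.

(** This is K_a: a coloring [p] blank at [a] together with a color blocked at [a] is an improper map
    that uncoloring [a] repairs. In the same way [multi_collisions] is M_a. *)
Definition collisions a := \sum_(p in colorings [set a] setT) blocked setT p a.

Definition multi_collisions a := \sum_(p in colorings [set a] setT) repeated p a.

Lemma card_into_nbrs a :
  #|colorings set0 (nbrs a)|
  + \sum_(p in colorings [set a] (nbrs a)) blocked (nbrs a) p a
  = #|nbrs a|.+1 * #|colorings [set a] (nbrs a)|.
Proof. by rewrite -[[set a]]setU0 card_colorings_at // inE. Qed.

Lemma nbrs_leq a : #|nbrs a| < #|V|.
Proof.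
rewrite -cardsT; apply: proper_card; apply/properP; split; first exact/subsetP.
by exists a; rewrite // inE e_irr.
Qed.

Lemma sum_blocked_lower_bound A D a :
  \sum_(v | e a v && (v \notin A)) \sum_(p in colorings (v |: A) D) unused D p
  <= \sum_(p in colorings A D) blocked D p a.
Proof.
have : \sum_(p in colorings A D) \sum_(v | e a v) unique_at p v
    <= \sum_(p in colorings A D) blocked D p a.
  by apply: leq_sum => p pX; exact: blocked_lower_bound pX.
apply: leq_trans; rewrite exchange_big big_mkcondr /=.
by apply: leq_sum => v eav; case: ifP => // vA; rewrite sum_unique_at.
Qed.

Lemma nbr_not_self a v : e a v -> v \notin [set a].
Proof. by rewrite inE; apply: contraL => /eqP ->; rewrite e_irr. Qed.

(** Each neighbor [v] of [a] that is alone in its class gives a collision. For fixed [v] there are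
    [#|V|] colors times the colorings blank at [a] and [v] with one color less, and restoring [v]
    costs at most a factor [#|D|.+1]. *)
Lemma collisions_lower_bound a D : #|V| = #|D|.+1 ->
  #|nbrs a| * #|colorings [set a] D| <= collisions a.
Proof.
move=> VD; have TD : #|[set: V]| = #|D|.+1 by rewrite cardsT.
apply: leq_trans (sum_blocked_lower_bound [set a] setT a).
rewrite (eq_bigl (mem (nbrs a))) /=; last first.
  by move=> v; rewrite [RHS]inE; apply: andb_idr; exact: nbr_not_self.
rewrite -sum_nat_const; apply: leq_sum => v.
rewrite inE => /nbr_not_self va; rewrite (sum_unused_card _ TD) TD.
exact: card_colorings_leq.
Qed.

Lemma exists_add_color D : #|D| < #|V| -> exists D', #|D'| = #|D|.+1.
Proof.
rewrite -cardsT => lt.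
have [c _ cD] : exists2 c, c \in setT & c \notin D.
  by apply/subsetPn; apply: contraL lt => /subset_leq_card; rewrite -leqNgt.
by exists (c |: D); rewrite cardsU1 cD.
Qed.


(** Let [d] be the degree and x the number of colorings blank at [a] with [d] colors. Two doublings
    give at least 4dx collisions, while at most (d+1)x colorings go into the neighborhood. For d = 0
    only the blank coloring remains, whence the term 2. *)
Lemma into_nbrs_low_degree a : #|nbrs a| + 3 <= #|V| ->
  2 * #|colorings set0 (nbrs a)| <= collisions a + 2.
Proof.
move=> le; have [d0|d0] := posnP #|nbrs a|.
  have := card_into_nbrs a; rewrite d0.
  have -> : #|colorings [set a] (nbrs a)| = 1; last by lia.
  apply/eqP/cards1P; exists [ffun=> None]; apply/setP => p; rewrite inE.
  apply/coloringsP/eqP => [[_ _ h]|->].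
    apply/ffunP => u; rewrite ffunE; case pu: (p u) => [c|] //.
    by move: (h _ _ pu); rewrite (cards0_eq d0) inE.
  by split=> [u v c|u|u c]; rewrite ffunE.
have [D1 D1d] : exists D', #|D'| = #|nbrs a|.+1 by apply: exists_add_color; lia.
have [D2 D2d] : exists D', #|D'| = #|D1|.+1 by apply: exists_add_color; lia.
have D3d : #|V| = #|~: [set a]|.+1 by rewrite cardsC1; lia.
have h1 := card_double (A := [set a]) D1d.
have h2 := card_double (A := [set a]) D2d.
have h3 : #|colorings [set a] D2| <= #|colorings [set a] (~: [set a])|.
  by apply: card_colorings_mono; lia.
have h4 := collisions_lower_bound a D3d.
have h5 := card_into_nbrs a.
have {}h1 := h1 ltac:(lia); have {}h2 := h2 ltac:(lia).
nia.
Qed.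

Lemma free_hub A D p a c : nbrs a = ~: [set a] -> p \in colorings (a |: A) D ->
  free p a c = (color_class p c == set0).
Proof.
move=> hub pX; have pa := blank_at pX; apply/freeP/class0P => h v.
  case: (eqVneq v a) => [->|va]; first by rewrite pa.
  by apply: h; have : v \in nbrs a; [rewrite hub !inE | rewrite inE].
by move=> _; exact: h.
Qed.

Lemma blocked_hub D p a : nbrs a = ~: [set a] -> p \in colorings [set a] D ->
  blocked D p a = used p.
Proof.
move=> hub; rewrite -[[set a]]setU0 => pX.
apply/eqP; rewrite -(eqn_add2r (unused D p)) (used_unused pX); apply/eqP.
rewrite -(cardsID [set c | free p a c] D) addnC; congr (_ + _).
  by apply: eq_card => c; rewrite !inE (free_hub _ hub pX).
by apply: eq_card => c; rewrite !inE andbC.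
Qed.

(** A used color not blocked at [a] occurs on some non-neighbor of [a]. *)
Lemma used_leq A D p a : p \in colorings (a |: A) D ->
  used p <= blocked D p a + \sum_(z in ~: (a |: nbrs a)) (p z != None).
Proof.
move=> pX; have pa := blank_at pX; have [_ _ hD] := coloringsP _ _ _ pX.
set Z := [set z in ~: (a |: nbrs a) | p z != None].
have -> : \sum_(z in ~: (a |: nbrs a)) (p z != None) = #|Z|.
  by rewrite -sum1dep_card big_mkcondr.
apply: leq_trans (leq_add (leqnn _) (leq_imset_card (fun z => odflt a (p z)) Z)).
apply: leq_trans (leq_card_setU _ _).
apply: subset_leq_card; apply/subsetP => c; rewrite !inE => /set0Pn [v].
rewrite inE => /eqP pv; rewrite (hD _ _ pv) /=.
case: (boolP (e a v)) => eav.
  by apply/orP; left; apply/freeP => /(_ v eav).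
apply/orP; right; apply/imsetP; exists v; last by rewrite pv.
rewrite !inE pv (negPf eav) orbF andbT.
by apply: contraPneq pv => ->; rewrite pa.
Qed.

Lemma sum_colored_at A D u : u \notin A ->
  \sum_(p in colorings A D) (p u != None) + #|colorings (u |: A) D|
  = #|colorings A D|.
Proof.
move=> uA; rewrite -!sum1_card !(sum_colorings_at _ _ uA) -big_split /=.
apply: eq_bigr => p pX; rewrite (blank_at pX) add0n addnC; congr (_ + _).
by apply: eq_bigr => c _; rewrite recolor_same.
Qed.

(** Let [z] be the only non-neighbor. By [used_leq], dx - Y is at most b plus the number of
    colorings with [z] colored, which is at most dx/(d+1). Averaging over the neighbors of [a] gives
    Y <= b. *)
Lemma sum_blocked_codegree1 a : #|nbrs a| + 2 = #|V| -> 0 < #|nbrs a| ->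
  #|nbrs a| ^ 2 * #|colorings [set a] (nbrs a)| <=
  2 * #|nbrs a|.+1 * \sum_(p in colorings [set a] (nbrs a)) blocked (nbrs a) p a.
Proof.
move=> dV d0; set D := nbrs a; set x := #|colorings _ _|.
set b := \sum_(p in _) _; set d := #|nbrs a|.
pose Y := \sum_(p in colorings [set a] D) unused D p.
have Yb : Y <= b.
  rewrite -(leq_pmul2l (m := d)) //.
  have := sum_blocked_lower_bound [set a] D a; rewrite -/b => h.
  apply: leq_trans (leq_mul (leqnn d) h); rewrite -sum_nat_const big_distrr /=.
  rewrite [X in _ <= X](eq_bigl (mem (nbrs a))) /=; last first.
    by move=> v; rewrite [RHS]inE; apply: andb_idr; exact: nbr_not_self.
  apply: leq_sum => v; rewrite inE => /nbr_not_self va.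
  exact: sum_unused_leq.
have Zc : #|~: (a |: nbrs a)| = 1.
  have := cardsC (a |: nbrs a); rewrite cardsU1 inE e_irr /= => h.
  by apply/eqP; rewrite -(eqn_add2l (1 + #|nbrs a|)) h -dV addn2 add1n addn1.
case/eqP/cards1P: Zc => z Zz.
have za : z \notin [set a].
  by have := set11 z; rewrite -Zz !inE => /norP [].
have h1 : \sum_(p in colorings [set a] D) used p
    <= b + \sum_(p in colorings [set a] D) (p z != None).
  rewrite /b -big_split /=; apply: leq_sum => p pX.
  have pX' : p \in colorings (a |: set0) D by rewrite setU0.
  by have := used_leq pX'; rewrite Zz big_set1.
have h2 := sum_colored_at D za; have h3 := card_colorings_leq D za.
have h4 := sum_used_unused [set a] D.
rewrite -/Y -/x -/d in h1 h2 h3 h4 Yb *.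
move: h1 h2 h3 h4; rewrite -/d.
set U := \sum_(p in _) used p; set C := \sum_(p in _) (_ != _).
set xz := #|colorings (z |: _) _| => h1 h2 h3 h4.
have h5 : d.+1 * U + x <= d.+1 * b + d.+1 * x by nia.
nia.
Qed.

(** From d >= 3 follows d^2 >= 2(d+1), hence x <= b, so at most dx colorings go into the
    neighborhood; one doubling yields 2dx collisions. *)
Lemma into_nbrs_codegree1 a : #|nbrs a| + 2 = #|V| -> 3 <= #|nbrs a| ->
  2 * #|colorings set0 (nbrs a)| <= collisions a.
Proof.
move=> dV d3.
have h1 := sum_blocked_codegree1 dV (leq_trans (isT : 0 < 3) d3).
have D3d : #|V| = #|~: [set a]|.+1 by rewrite cardsC1; lia.
have D1d : #|~: [set a]| = #|nbrs a|.+1 by lia.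
have h2 := card_double (A := [set a]) D1d ltac:(lia).
have h3 := collisions_lower_bound a D3d.
have h4 := card_into_nbrs a.
move: h1 h2 h3 h4; set x := #|colorings [set a] (nbrs a)|.
set b := \sum_(p in _) _; set d := #|nbrs a| in d3 *.
set x' := #|colorings [set a] (~: _)| => h1 h2 h3 h4.
have xb : x <= b.
  rewrite -(leq_pmul2l (m := 2 * d.+1)) //; apply: leq_trans h1.
  rewrite leq_mul2r; apply/orP; right; nia.
nia.
Qed.

(** * A vertex adjacent to all others *)

Section Hub.
Variable a : V.
Hypothesis hub : nbrs a = ~: [set a].
Let d := #|nbrs a|.
Let x := #|colorings [set a] (nbrs a)|.
Let Y := \sum_(p in colorings [set a] (nbrs a)) unused (nbrs a) p.
(** The pairs are ordered, so this is twice the number of non-edges avoiding [a]. *)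
Let nonadj := \sum_(u | u \notin [set a])
  \sum_(v | [&& v \notin [set a], u != v & ~~ e u v]) 1.

Lemma card_hub : #|V| = d.+1.
Proof. by rewrite /d hub cardsC1 prednK //; apply/card_gt0P; exists a. Qed.

Lemma cardT_hub : #|[set: V]| = #|nbrs a|.+1.
Proof. by rewrite cardsT card_hub. Qed.

(** A hub is either blank or has a color that no other vertex uses. *)
Lemma card_into_hub : #|colorings set0 (nbrs a)| = x + Y.
Proof.
have h1 := card_into_nbrs a; have h2 := sum_used_unused [set a] (nbrs a).
have h3 : \sum_(p in colorings [set a] (nbrs a)) blocked (nbrs a) p a =
          \sum_(p in colorings [set a] (nbrs a)) used p.
  by apply: eq_bigr => p pX; exact: blocked_hub.
rewrite /x /Y; lia.
Qed.

Lemma collisions_hub :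
  collisions a = \sum_(p in colorings [set a] setT) used p.
Proof. by apply: eq_bigr => p pX; exact: blocked_hub. Qed.

Lemma hub_nonadj_card u v : u != a -> v != a -> u != v ->
  x <= d.+1 ^ 2 * #|colorings (v |: (u |: [set a])) (nbrs a)|.
Proof.
move=> ua va uv.
have h1 : x <= d.+1 * #|colorings (u |: [set a]) (nbrs a)|.
  by apply: card_colorings_leq; rewrite inE.
apply: (leq_trans h1); rewrite expnS expn1 -mulnA leq_mul2l; apply/orP; right.
by apply: card_colorings_leq; rewrite !inE negb_or eq_sym uv.
Qed.

Lemma hub_pair_unused u v : u != a -> v != a -> u != v ->
  Y <= d ^ 2 * \sum_(p in colorings (v |: (u |: [set a])) (nbrs a)) unused (nbrs a) p.
Proof.
move=> ua va uv.
have h1 : Y <= d * \sum_(p in colorings (u |: [set a]) (nbrs a)) unused (nbrs a) p.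
  by apply: sum_unused_leq; rewrite inE.
apply: (leq_trans h1); rewrite expnS expn1 -mulnA leq_mul2l; apply/orP; right.
by apply: sum_unused_leq; rewrite !inE negb_or eq_sym uv.
Qed.

(** A class formed by two non-adjacent vertices is a color repeated on neighbors of the hub, met
    once in each order. With one color removed, uncoloring both vertices costs at most [d.+1 ^ 2],
    and the choice of the color returns a factor [d.+1]. *)
Lemma multi_collisions_hub : nonadj * x <= 2 * d.+1 * multi_collisions a.
Proof.
have h1 : \sum_(p in colorings [set a] setT) \sum_u \sum_v pair_at p u v
    <= 2 * multi_collisions a.
  rewrite big_distrr /=; apply: leq_sum => p pX.
  apply: leq_trans (repeated_lower_bound p) _; rewrite leq_mul2l /=.
  apply: subset_leq_card; apply/subsetP => c; rewrite !inE.
  suff /setIidPr -> : color_class p c \subset nbrs a by [].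
  have pa : p a = None by case/coloringsP: pX => _ h _; apply: h; rewrite set11.
  apply/subsetP => v; rewrite hub !inE => /eqP pv.
  by apply: contraPneq pv => ->; rewrite pa.
have h2 := leq_trans (sum_pairs_lower_bound [set a] setT) h1.
rewrite [X in _ <= X](mulnAC 2) [X in _ <= X]mulnC.
apply: leq_trans (leq_mul (leqnn d.+1) h2).
rewrite big_distrl big_distrr /=; apply: leq_sum => u; rewrite inE => ua.
rewrite big_distrl big_distrr /=; apply: leq_sum => v.
rewrite inE => /and3P [va uv nuv].
rewrite (sum_unused_card _ cardT_hub) cardT_hub mul1n mulnA.
exact: hub_nonadj_card.
Qed.

Let adj := \sum_(u | u \notin [set a]) \sum_(v | e u v && (v \notin u |: [set a])) 1.

Lemma adj_nonadj : adj + nonadj = d * d.-1.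
Proof.
have dE : d = #|~: [set a]| by rewrite /d hub.
rewrite /adj /nonadj -big_split /= {1}dE -sum_nat_const.
rewrite (eq_bigl (mem (~: [set a]))) /=; last by move=> u; rewrite !inE.
apply: eq_bigr => u; rewrite !inE => ua.
rewrite big_mkcond [X in _ + X]big_mkcond -big_split /=.
rewrite (eq_bigr (fun v => if v \in ~: (u |: [set a]) then 1 else 0)); last first.
  move=> v _; rewrite !inE (eq_sym u v) !negb_or.
  by case: (e u v) => /=; case: (v == u) => /=; case: (v == a).
rewrite -big_mkcond sum1_card /=.
apply/eqP; rewrite -(eqn_add2l #|u |: [set a]|) cardsC card_hub.
rewrite cards2 ua /= add2n; case: (d) (dE) => // /esym/eqP.
by rewrite cards_eq0 => /eqP/setP/(_ u); rewrite !inE ua.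
Qed.

(** In U + Y = dx, singleton classes contribute at least Y to U, and pair classes at least
    [nonadj * Y] divided by [2 * d ^ 2]. *)
Lemma hub_unused_bound : (4 * d ^ 2 + nonadj) * Y <= 2 * d ^ 3 * x.
Proof.
have h1 := sum_used_lower_bound [set a] (nbrs a).
have h2 := sum_used_unused [set a] (nbrs a).
rewrite -/Y -/x -/d in h2.
move: h1 h2; set U := \sum_(p in _) used p.
set S1 := \sum_(u | _) _; set S2 := \sum_(u | _) _ => h1 h2.
have h3 : d * Y <= d * S1.
  have -> : d * Y = \sum_(u | u \notin [set a]) Y.
    rewrite /d hub -sum_nat_const; apply: eq_bigl => u; by rewrite !inE.
  rewrite /S1 big_distrr /=; apply: leq_sum => u ua; exact: sum_unused_leq.
have h4 : nonadj * Y <= d ^ 2 * S2.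
  rewrite /S2 big_distrl [X in _ <= X]big_distrr /=; apply: leq_sum => u; rewrite inE => ua.
  rewrite big_distrl [X in _ <= X]big_distrr /=; apply: leq_sum => v.
  rewrite inE mul1n => /and3P [va uv nuv]; exact: hub_pair_unused.
move: h1 h2 h3 h4; rewrite !expnS expn0 !muln1 => h1 h2 h3 h4.
have h5 : d * d * (2 * S1 + S2) <= d * d * (2 * U) by rewrite leq_mul2l h1 orbT.
have h6 : d * (d * Y) <= d * (d * S1) by rewrite leq_mul2l h3 orbT.
have h7 : d * d * (U + Y) = d * d * (d * x) by rewrite h2.
nia.
Qed.

(** At a hub the collisions are the used colors, which singleton and pair classes bound below. The
    term with [adj] refines the singleton count: when [u] is uncolored, each neighbor of [u] other
    than [a] blocks colors, in total at least Y divided by [d ^ 2]. *)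
Lemma hub_collisions_bound :
  2 * d.+1 * d ^ 3 * x + 2 * d.+1 * adj * Y + d ^ 2 * nonadj * x
  <= 2 * d ^ 2 * d.+1 * collisions a.
Proof.
have h1 := sum_used_lower_bound [set a] setT; rewrite -collisions_hub in h1.
pose xu u := #|colorings (u |: [set a]) (nbrs a)|.
pose x2 u v := #|colorings (v |: (u |: [set a])) (nbrs a)|.
have {}h1 : \sum_(u | u \notin [set a]) (2 * d.+1 * xu u +
     \sum_(v | [&& v \notin [set a], u != v & ~~ e u v]) d.+1 * x2 u v)
    <= 2 * collisions a.
  apply: leq_trans h1; rewrite big_split /= leq_add //.
    rewrite big_distrr /=; apply: leq_sum => u _.
    by rewrite (sum_unused_card _ cardT_hub) cardT_hub mulnA.
  apply: leq_sum => u _; apply: leq_sum => v _.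
  by rewrite (sum_unused_card _ cardT_hub) cardT_hub.
have h2 u : u != a -> d ^ 2 * x +
     (\sum_(v | e u v && (v \notin u |: [set a])) 1) * Y <= d ^ 2 * d.+1 * xu u.
  move=> ua; have ua' : u \notin [set a] by rewrite inE.
  rewrite -mulnA -(card_colorings_at _ ua') mulnDr leq_add2l.
  apply: leq_trans (leq_mul (leqnn _) (sum_blocked_lower_bound _ _ u)).
  rewrite big_distrl [X in _ <= X]big_distrr /=; apply: leq_sum => v.
  rewrite !inE negb_or mul1n => /and3P [euv vu va].
  by apply: hub_pair_unused; rewrite // eq_sym.
have -> : 2 * d ^ 2 * d.+1 * collisions a = d ^ 2 * d.+1 * (2 * collisions a).
  by rewrite [RHS]mulnCA !mulnA.
apply: leq_trans (leq_mul (leqnn _) h1); rewrite [X in _ <= X]big_distrr /=.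
have E : 2 * d.+1 * d ^ 3 * x = \sum_(u | u \notin [set a]) 2 * d.+1 * (d ^ 2 * x).
  rewrite (eq_bigl (mem (~: [set a]))) /=; last by move=> u; rewrite !inE.
  rewrite sum_nat_const -hub -/d; rewrite !expnS expn0 !muln1; nia.
have E2 : 2 * d.+1 * adj * Y = \sum_(u | u \notin [set a])
    2 * d.+1 * ((\sum_(v | e u v && (v \notin u |: [set a])) 1) * Y).
  by rewrite -[LHS]mulnA /adj big_distrl [LHS]big_distrr.
have E3 : d ^ 2 * nonadj * x = \sum_(u | u \notin [set a])
    d ^ 2 * ((\sum_(v | [&& v \notin [set a], u != v & ~~ e u v]) 1) * x).
  by rewrite -[LHS]mulnA /nonadj big_distrl [LHS]big_distrr.
rewrite E E2 E3 -!big_split /=; apply: leq_sum => u; rewrite inE => ua.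
rewrite mulnDr; apply: leq_add.
  have := leq_mul (leqnn (2 * d.+1)) (h2 u ua); rewrite mulnDr => h.
  apply: leq_trans h _; nia.
rewrite -[X in _ <= X]mulnA leq_mul2l; apply/orP; right.
rewrite big_distrl [X in _ <= X]big_distrr /=; apply: leq_sum => v.
rewrite inE mul1n => /and3P [va uv nuv]; rewrite mulnA mulnn.
exact: hub_nonadj_card.
Qed.

(** Replace [adj] by [d * d.-1 - nonadj], then eliminate Y with [hub_unused_bound]; a polynomial
    inequality in [d] and N remains. *)
Lemma into_nbrs_hub : 5 <= d -> 2 * #|colorings set0 (nbrs a)| <= collisions a.
Proof.
move=> d5; rewrite card_into_hub.
have h1 := hub_collisions_bound; have h2 := hub_unused_bound.
have h3 := adj_nonadj.
move: h1 h2 h3; set N := nonadj; set B := adj; set K := collisions a.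
move: d5; clearbody d x Y N B K => d5 h1 h2 h3.
have W0 : 0 < 4 * d ^ 2 + N by rewrite !expnS; nia.
have P0 : 0 < 2 * d ^ 2 * d.+1 by rewrite !expnS; nia.
rewrite -(leq_pmul2l P0); apply: leq_trans h1.
suff : 2 * d.+1 * (d * d.+1 + N) * Y + 4 * d ^ 2 * d.+1 * x
    <= 2 * d.+1 * d ^ 3 * x + d ^ 2 * N * x.
  have -> : 2 * d.+1 * B * Y = 2 * d.+1 * (d * d.-1 - N) * Y by congr (_ * _ * _); lia.
  have : N <= d * d.-1 by lia.
  case: d d5 => // d' _ /=; rewrite !expnS !expn0 => hN h; nia.
rewrite -(leq_pmul2l W0) mulnDr.
have h4 : (4 * d ^ 2 + N) * (2 * d.+1 * (d * d.+1 + N) * Y)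
    <= 2 * d.+1 * (d * d.+1 + N) * (2 * d ^ 3 * x).
  by rewrite mulnCA leq_mul2l h2 orbT.
apply: leq_trans (leq_add h4 (leqnn _)) _.
have [t dt] : exists t, d = t + 5 by exists (d - 5); lia.
(* For N = 0 this says exactly d >= 5, up to a positive factor; hence the substitution
   [d = t + 5]. *)
suff h5 : 4 * d.+1 * d * (d * d.+1 + N) + (4 * d ^ 2 + N) * (4 * d.+1)
    <= (4 * d ^ 2 + N) * (2 * d.+1 * d + N).
  have := leq_mul (leqnn (d ^ 2 * x)) h5.
  rewrite !expnS !expn0; nia.
rewrite dt !expnS !expn0; nia.
Qed.

End Hub.

End PartialColorings.

(** * Counting the colorings of small graphs by computation *)

Section Enumeration.
Variables (V : finType) (e : rel V).
Hypotheses (e_sym : symmetric e) (e_irr : irreflexive e).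
Implicit Types (p : {ffun V -> option V}) (A D : {set V}) (u v w c : V).

(** The recursion of [sum_colorings_at] iterated along [us], to be run from the blank coloring. *)
Fixpoint extensions D us p : nat :=
  if us is u :: us' then
    extensions D us' p
    + \sum_(c in D | free e p u c) extensions D us' (recolor p u (Some c))
  else 1.

Lemma sum_extensions A D us : uniq us -> {in us, forall u, u \notin A} ->
  \sum_(p in colorings e (foldr (fun u B => u |: B) A us) D) extensions D us p
  = #|colorings e A D|.
Proof.
elim: us => [|u us IH] /=; first by rewrite sum1_card.
case/andP => uus us_uniq hA; rewrite -IH //; last first.
  by move=> w wus; apply: hA; rewrite inE wus orbT.
rewrite [RHS](@sum_colorings_at _ _ e_sym e_irr _ _ u) //.
have : u \notin A by apply: hA; rewrite inE eqxx.
elim: us uus {IH us_uniq hA} => [|w us IH] //=.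
by rewrite inE negb_or in_setU1 negb_or => /andP [-> /IH h] /h ->.
Qed.

Lemma card_extensions D a us : uniq us -> us =i ~: [set a] ->
  #|colorings e [set a] D| = extensions D us [ffun=> None].
Proof.
move=> us_uniq usE; rewrite -(@sum_extensions [set a] D us) //; last first.
  by move=> u; rewrite usE !inE.
set B := foldr _ _ _.
have BT : B = setT.
  apply/setP => u; rewrite inE.
  have : (u \in us) || (u \in [set a]) by rewrite usE in_setC orNb.
  rewrite /B; elim: us {us_uniq usE B} => [|w us IH] //=.
  by rewrite in_cons in_setU1; case: (u == w).
have -> : colorings e B D = [set [ffun=> None]].
  apply/setP => p; rewrite in_set1; apply/coloringsP/eqP => [[_ h _]|->].
    by apply/ffunP => u; rewrite ffunE h // BT inE.
  by split=> [u v c|u|u c]; rewrite ffunE.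
by rewrite big_set1.
Qed.

(* [count_extensions j rows s] counts the proper extensions of a partial
   coloring with [j] colors: [s] lists the colors given so far (0 for a blank
   vertex), most recent first, and each row of [rows] describes a vertex still
   to be colored by its adjacencies to the vertices listed in [s]. *)
Fixpoint count_extensions (j : nat) (rows : seq (seq bool)) (s : seq nat) : nat :=
  if rows is r :: rows' then
    count_extensions j rows' (0 :: s)
    + sumn [seq count_extensions j rows' (i :: s)
           | i <- iota 1 j & all (fun bk => ~~ (bk.1 && (bk.2 == i))) (zip r s)]
  else 1.

Fixpoint adjacency_rows ws us : seq (seq bool) :=
  if us is u :: us' then [seq e u w | w <- ws] :: adjacency_rows (u :: ws) us'
  else [::].

Definition color_code D x0 (i : nat) : option V :=
  if i is i'.+1 then Some (nth x0 (enum D) i') else None.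

(** Color number [i.+1] is the entry of index [i] in [enum D], and 0 means blank. As [ws] and [s]
    grow in parallel, only the size of [D] and the adjacencies matter. *)
Lemma extensions_count D x0 us ws p s : uniq us ->
  {in us, forall u, u \notin ws} ->
  (forall v, v \notin ws -> p v = None) ->
  [seq p w | w <- ws] = [seq color_code D x0 i | i <- s] ->
  all (fun i => i <= #|D|) s ->
  extensions D us p = count_extensions #|D| (adjacency_rows ws us) s.
Proof.
elim: us ws p s => [|u us IH] //= ws p s /andP [uus us_uniq] hw hp ps sD.
have uws : u \notin ws by apply: hw; rewrite inE eqxx.
have hw' : {in us, forall u', u' \notin u :: ws}.
  move=> u' u'us; rewrite inE negb_or hw ?inE ?u'us ?orbT // andbT.
  by apply: contraNneq uus => <-.
congr (_ + _).
  apply: IH => //=; last by rewrite hp ?ps.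
  by move=> v; rewrite inE negb_or => /andP [_ /hp].
have freeE i : 0 < i <= #|D| -> free e p u (nth x0 (enum D) i.-1) =
    all (fun bk => ~~ (bk.1 && (bk.2 == i))) (zip [seq e u w | w <- ws] s).
  case: i => // i /= iD.
  have -> : free e p u (nth x0 (enum D) i) =
      all (fun w => ~~ (e u w && (p w == Some (nth x0 (enum D) i)))) ws.
    apply/freeP/allP => [h w wws|h v euv pv].
      by apply/negP => /andP [/h h' /eqP].
    have vws : v \in ws by apply: contraPT pv => /hp ->.
    by move: (h v vws); rewrite euv pv eqxx.
  elim: ws s ps sD {IH hw hp uws hw'} => [|w ws IH] [|k s] //= [pw ps] /andP [kD sD].
  rewrite (IH s) //; congr (~~ (_ && _) && _); rewrite pw.
  case: k kD {pw} => //= k kD; rewrite eqSS.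
  rewrite (inj_eq Some_inj) nth_uniq ?enum_uniq //; by rewrite -cardE.
rewrite sumnE big_map big_filter.
have -> : iota 1 #|D| = [seq i.+1 | i <- iota 0 #|D|].
  by rewrite (iotaDl 1 0).
rewrite big_map -big_enum_cond.
have {1}-> : enum D = [seq nth x0 (enum D) i | i <- iota 0 #|D|].
  by rewrite cardE map_nth_iota0 // take_size.
rewrite big_map big_seq_cond [RHS]big_seq_cond.
apply: eq_big => [i|i /andP []]; rewrite mem_iota add0n.
  by case: (boolP (0 <= i < #|D|)) => //= iD; rewrite (freeE i.+1).
move=> /andP [_ iD] _; apply: IH => //=; last by rewrite iD.
  move=> v; rewrite inE negb_or => /andP [vu /hp pv].
  by rewrite recolor_other.
rewrite recolor_same; congr (_ :: _); rewrite -ps.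
apply/eq_in_map => w wws; rewrite recolor_other //.
by apply: contraNneq uws => <-.
Qed.

Lemma card_count D a us : uniq us -> us =i ~: [set a] ->
  #|colorings e [set a] D| = count_extensions #|D| (adjacency_rows [::] us) [::].
Proof.
move=> us_uniq usE; rewrite (card_extensions _ us_uniq usE).
apply: (@extensions_count D a) => // v _; by rewrite ffunE.
Qed.

End Enumeration.

(** All graphs on the three vertices other than [a]. The first inequality serves degree 2, the
    second a hub of degree 3; the coefficients clear the denominators of [sum_blocked_codegree1] and
    [multi_collisions_hub]. *)
Lemma count_3 b1 b2 b3 :
  let z j := count_extensions j [:: [::]; [:: b1]; [:: b2; b3]] [::] in
  (14 * z 2 <= 6 * z 3 + 6)
  && (16 * (z 3 + 3 * z 2) + 32 * z 3
      <= 32 * z 4 + 2 * (~~ b1 + ~~ b2 + ~~ b3) * z 3 + 16).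
Proof. by case: b1; case: b2; case: b3; vm_compute. Qed.

Lemma count_4 b1 b2 b3 b4 b5 b6 :
  let z j := count_extensions j
    [:: [::]; [:: b1]; [:: b2; b3]; [:: b4; b5; b6]] [::] in
  2 * (z 4 + 4 * z 3) + 5 * z 4 <= 5 * z 5 + 2.
Proof.
by case: b1; case: b2; case: b3; case: b4; case: b5; case: b6; vm_compute.
Qed.

(** * The local inequality for every vertex *)

Section Local.
Variables (V : finType) (e : rel V).
Hypotheses (e_sym : symmetric e) (e_irr : irreflexive e).
Implicit Types (a u v : V) (D : {set V}).

Lemma exists_drop_color D : 0 < #|D| -> exists D', #|D| = #|D'|.+1.
Proof.
case/card_gt0P => c cD; exists (D :\ c).
by rewrite (cardsD1 c) cD.
Qed.

Lemma sum_other_vertices a us (F : V -> nat) : uniq us -> us =i ~: [set a] ->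
  \sum_(u | u \notin [set a]) F u = \sum_(u <- us) F u.
Proof.
move=> us_uniq usE; rewrite big_uniq //=; apply: eq_bigl => u.
by rewrite usE in_setC.
Qed.

Lemma hub_counts a us : nbrs e a = ~: [set a] -> uniq us -> us =i ~: [set a] ->
  0 < size us ->
  let z j := count_extensions j (adjacency_rows e [::] us) [::] in
  #|nbrs e a| = size us /\
  [/\ #|colorings e [set a] (nbrs e a)| = z (size us),
      #|colorings e set0 (nbrs e a)| = z (size us) + size us * z (size us).-1
    & collisions e a + (size us).+1 * z (size us) = (size us).+1 * z (size us).+1].
Proof.
move=> hub us_uniq usE us0 z.
have dE : #|nbrs e a| = size us.
  by rewrite hub -(card_uniqP us_uniq); apply: eq_card => u; rewrite usE.
have zE D : #|colorings e [set a] D| = z #|D| by exact: card_count.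
have TE := cardT_hub hub; rewrite -dE.
split=> //; split=> //.
  have [D' D'E] : exists D', #|nbrs e a| = #|D'|.+1.
    by apply: exists_drop_color; rewrite dE.
  rewrite (card_into_hub e_sym e_irr hub).
  by rewrite (sum_unused_card e [set a] D'E) !zE D'E.
rewrite (collisions_hub hub).
have := sum_used_unused e [set a] setT.
by rewrite (sum_unused_card e [set a] TE) !zE TE.
Qed.

Lemma into_nbrs_hub4 a : nbrs e a = ~: [set a] -> #|nbrs e a| = 4 ->
  2 * #|colorings e set0 (nbrs e a)| <= collisions e a + 2.
Proof.
move=> hub d4; pose us := enum (~: [set a]).
have us_uniq : uniq us by exact: enum_uniq.
have usE : us =i ~: [set a] by move=> u; rewrite mem_enum.
have us4 : size us = 4 by rewrite /us -cardE -hub.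
move: us us4 us_uniq usE => [|u1 [|u2 [|u3 [|u4 [|? ?]]]]] // _ us_uniq usE.
have [_ [_ -> h]] := hub_counts hub us_uniq usE isT.
have := count_4 (e u2 u1) (e u3 u2) (e u3 u1) (e u4 u3) (e u4 u2) (e u4 u1).
move: h; cbn [size predn adjacency_rows map].
set z3 := count_extensions 3 _ _; set z4 := count_extensions 4 _ _.
set z5 := count_extensions 5 _ _; move: z3 z4 z5 => z3 z4 z5; lia.
Qed.

Lemma into_nbrs_hub3 a : nbrs e a = ~: [set a] -> #|nbrs e a| = 3 ->
  2 * #|colorings e set0 (nbrs e a)| <= collisions e a + multi_collisions e a + 2.
Proof.
move=> hub d3; pose us := enum (~: [set a]).
have us_uniq : uniq us by exact: enum_uniq.
have usE : us =i ~: [set a] by move=> u; rewrite mem_enum.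
have us3 : size us = 3 by rewrite /us -cardE -hub.
move: us us3 us_uniq usE => [|u1 [|u2 [|u3 [|? ?]]]] // _ us_uniq usE.
have [_ [x3 -> h]] := hub_counts hub us_uniq usE isT.
have := multi_collisions_hub e_sym e_irr hub; rewrite x3 d3.
have -> : \sum_(u | u \notin [set a])
    \sum_(v | [&& v \notin [set a], u != v & ~~ e u v]) 1
    = 2 * (~~ e u2 u1 + ~~ e u3 u2 + ~~ e u3 u1).
  have E u : \sum_(v | [&& v \notin [set a], u != v & ~~ e u v]) 1 =
      \sum_(v <- [:: u1; u2; u3]) ((u != v) && ~~ e u v).
    by rewrite -(sum_other_vertices _ us_uniq usE) big_mkcondr.
  rewrite (sum_other_vertices _ us_uniq usE) !big_cons !big_nil !E.
  rewrite !big_cons !big_nil !eqxx.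
  move: us_uniq; rewrite /= !inE !negb_or andbT => /andP [/andP [h12 h13] h23].
  rewrite (eq_sym u2 u1) (eq_sym u3 u1) (eq_sym u3 u2) h12 h13 h23 /=.
  rewrite (e_sym u1 u2) (e_sym u1 u3) (e_sym u2 u3); lia.
have /andP [_] := count_3 (e u2 u1) (e u3 u2) (e u3 u1).
move: h; cbn [size predn adjacency_rows map].
set z2 := count_extensions 2 _ _; set z3 := count_extensions 3 _ _.
set z4 := count_extensions 4 _ _; set N := 2 * (~~ _ + _ + _) * z3.
move: N; move: z2 z3 z4 => z2 z3 z4 N; lia.
Qed.

Lemma into_nbrs_degree2 a : #|V| = 4 -> #|nbrs e a| = 2 ->
  2 * #|colorings e set0 (nbrs e a)| <= collisions e a + 2.
Proof.
move=> V4 d2; pose us := enum (~: [set a]).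
have us_uniq : uniq us by exact: enum_uniq.
have usE : us =i ~: [set a] by move=> u; rewrite mem_enum.
have us3 : size us = 3 by rewrite /us -cardE cardsC1 V4.
have D3d : #|V| = #|~: [set a]|.+1 by rewrite cardsC1 V4.
have c3 : #|~: [set a]| = 3 by rewrite cardsC1 V4.
have zE D := @card_count V e e_sym e_irr D a us us_uniq usE.
have h1 := @sum_blocked_codegree1 V e e_sym e_irr a.
rewrite d2 V4 in h1; have {}h1 := h1 erefl isT.
have h2 := collisions_lower_bound e_sym e_irr a D3d.
have h3 := card_into_nbrs e_sym e_irr a.
rewrite !zE d2 in h1 h3; rewrite zE c3 d2 in h2.
move: us us3 us_uniq usE zE h1 h2 h3 => [|u1 [|u2 [|u3 [|? ?]]]] // _ _ _ _.
have /andP [] := count_3 (e u2 u1) (e u3 u2) (e u3 u1).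
cbn [size predn adjacency_rows map].
set z2 := count_extensions 2 _ _; set z3 := count_extensions 3 _ _.
move: z2 z3 => z2 z3; set b := \sum_(p in _) _; lia.
Qed.

(** The cases are: at least two non-neighbors other than [a], exactly one, and none. In the last
    case [a] is a hub of degree at least 3. *)
Lemma into_nbrs_bound a : 4 <= #|V| ->
  2 * #|colorings e set0 (nbrs e a)| <= collisions e a + multi_collisions e a + 2.
Proof.
move=> V4; have dV := nbrs_leq e_irr a.
have [low|high] := leqP (#|nbrs e a| + 3) #|V|.
  apply: leq_trans (into_nbrs_low_degree e_sym e_irr low) _.
  by rewrite leq_add2r leq_addr.
have [c1|nc1] := eqVneq (#|nbrs e a| + 2) #|V|.
  have [d3|d2] := leqP 3 #|nbrs e a|.
    apply: leq_trans (into_nbrs_codegree1 e_sym e_irr c1 d3) _.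
    by rewrite -addnA leq_addr.
  have dE : #|nbrs e a| = 2 by lia.
  apply: leq_trans (into_nbrs_degree2 _ dE) _; first by rewrite -c1 dE.
  by rewrite leq_add2r leq_addr.
have dE : #|nbrs e a| = #|~: [set a]| by rewrite cardsC1; move: nc1 high dV; lia.
have hub : nbrs e a = ~: [set a].
  apply/eqP; rewrite eqEcard dE leqnn andbT; apply/subsetP => v.
  by rewrite inE in_setC => /(nbr_not_self e_irr).
have [d5|d4] := leqP 5 #|nbrs e a|.
  apply: leq_trans (into_nbrs_hub e_sym e_irr hub d5) _.
  by rewrite -addnA leq_addr.
have [d4'|d4'] := eqVneq #|nbrs e a| 4.
  apply: leq_trans (into_nbrs_hub4 hub d4') _.
  by rewrite leq_add2r leq_addr.
apply: into_nbrs_hub3 => //; move: dE; rewrite cardsC1; lia.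
Qed.

(** * Summation over all vertices *)

Definition collides_at (g : {ffun V -> option V}) a :=
  if g a is Some c then ~~ free e g a c else false.

Definition multi_collides_at (g : {ffun V -> option V}) a :=
  if g a is Some c then 1 < #|nbrs e a :&: color_class g c| else false.

(** A coloring blank at [a] and a color for [a] together form the map [g]. *)
Lemma collisions_sum a :
  collisions e a + multi_collisions e a <=
  \sum_(g : {ffun V -> option V}) proper_coloring e (recolor g a None)
     * (collides_at g a + multi_collides_at g a).
Proof.
(* For the graph without edges every map is a proper coloring, so [sum_colorings_at] splits the sum
   over all [g] by the value at [a]. *)
pose e0 : rel V := fun _ _ => false.
have e0_sym : symmetric e0 by [].
have e0_irr : irreflexive e0 by [].
have X0 : colorings e0 set0 setT = setT.
  by apply/setP => g; rewrite in_setT; apply/coloringsP; split=> // u; rewrite inE.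
rewrite [X in _ <= X](eq_bigl (mem (colorings e0 set0 setT))); last first.
  by move=> g /=; rewrite X0 in_setT.
rewrite (@sum_colorings_at V e0 e0_sym e0_irr set0 setT a) ?inE // setU0.
rewrite /collisions /multi_collisions -big_split /=.
rewrite [X in X <= _]big_mkcond [X in _ <= X]big_mkcond /=.
apply: leq_sum => p _; case: ifP => // pX.
have [hp pa _] := coloringsP _ _ _ _ pX.
have {}pa : p a = None by apply: pa; rewrite set11.
rewrite ifT; last first.
  by apply/coloringsP; split=> // u; rewrite inE => /eqP ->.
apply: leq_trans (leq_addl _ _).
rewrite /blocked /repeated -!sum1dep_card.
rewrite [X in X + _]big_mkcond [X in _ + X]big_mkcond -big_split /=.
rewrite [X in _ <= X]big_mkcond /=; apply: leq_sum => c _.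
rewrite !in_setT [X in _ <= X]ifT /=; last by apply/freeP => v.
rewrite recolorK // (_ : proper_coloring e p) ?mul1n; last exact/proper_coloringP.
rewrite /collides_at /multi_collides_at recolor_same.
have -> : nbrs e a :&: color_class (recolor p a (Some c)) c
    = nbrs e a :&: color_class p c.
  apply/setP => v; rewrite !inE; case: (boolP (e a v)) => //= eav.
  by rewrite recolor_other //; apply: contraTneq eav => ->; rewrite e_irr.
have -> : free e (recolor p a (Some c)) a c = free e p a c.
  apply: eq_forallb => v; case: (boolP (e a v)) => //= eav.
  by rewrite recolor_other //; apply: contraTneq eav => ->; rewrite e_irr.
by case: (free e p a c); case: (1 < _).
Qed.

(* If uncoloring [a] repairs [g], then every monochromatic edge contains [a];
   hence [g] is counted for at most the two ends of one such edge, and for a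
   single vertex as soon as there are two of them. *)
Lemma collisions_at_most_2 (g : {ffun V -> option V}) :
  \sum_a proper_coloring e (recolor g a None)
     * (collides_at g a + multi_collides_at g a) <= 2 * ~~ proper_coloring e g.
Proof.
have edgeP a c v b : g a = Some c -> e a v -> g v = Some c ->
    proper_coloring e (recolor g b None) -> b \in [:: a; v].
  move=> ga eav gv /proper_coloringP h; rewrite !inE.
  case: (eqVneq b a) => //= ba; apply: contraT => bv.
  case: (h a v c eav); rewrite recolor_other //; by rewrite eq_sym.
have multi1 a : multi_collides_at g a -> collides_at g a.
  rewrite /multi_collides_at /collides_at; case ga: (g a) => [c|] //.
  move=> /ltnW /card_gt0P [v]; rewrite !inE => /andP [eav /eqP gv].
  by apply/freeP => /(_ v eav).
case: (boolP [exists a, proper_coloring e (recolor g a None) && collides_at g a]);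
  last first.
  move=> h; rewrite big1 // => a _.
  case: (boolP (proper_coloring _ _)) => //= ha; case: (boolP (collides_at g a)) => hc.
    by case/existsP: h; exists a; rewrite ha hc.
  by rewrite (negPf (contra (@multi1 a) hc)).
case/existsP => a /andP [pa ca].
have ng : ~~ proper_coloring e g.
  move: ca; rewrite /collides_at; case ga: (g a) => [c|] // /freeP nf.
  by apply/proper_coloringP => h; case: nf => v eav; exact: (h a v c).
rewrite ng muln1.
case: (boolP [exists b, proper_coloring e (recolor g b None) && multi_collides_at g b]).
  case/existsP => b /andP [pb mb].
  rewrite (bigD1 b) //= big1 ?addn0; last first.
    move=> b' bb'; case: (boolP (proper_coloring _ _)) => //= pb'.
    move: mb; rewrite /multi_collides_at; case gb: (g b) => [c|] //.
    case/card_gt1P => v [w [vb wb vw]].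
    move: vb wb; rewrite !inE => /andP [ebv /eqP gv] /andP [ebw /eqP gw].
    have := edgeP _ _ _ _ gb ebv gv pb'; have := edgeP _ _ _ _ gb ebw gw pb'.
    rewrite !inE (negPf bb') /= => /eqP -> /eqP wv.
    by rewrite wv eqxx in vw.
  by rewrite pb mb; case: (collides_at _ _).
move=> nomulti; move: (ca); rewrite /collides_at; case ga: (g a) => [c|] //.
case/forallPn => v; rewrite negb_imply negbK => /andP [eav /eqP gv].
have le1 b : proper_coloring e (recolor g b None)
     * (collides_at g b + multi_collides_at g b) <= (b \in [:: a; v]).
  case: (boolP (proper_coloring e _)) => //= pb; rewrite mul1n.
  rewrite (edgeP _ _ _ _ ga eav gv pb).
  case: (boolP (multi_collides_at g b)) => mb; last by case: (collides_at g b).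
  by case/existsP: nomulti; exists b; rewrite pb mb.
apply: (@leq_trans (\sum_b (b \in [:: a; v]))).
  by apply: leq_sum => b _; exact: le1.
rewrite -big_mkcond /= sum1_card; exact: card_size.
Qed.

(** Summed over [a], the local inequality bounds twice the second term by twice the number of
    improper maps plus [2 * #|V|]; proper and improper maps together are all partial maps. *)
Lemma colorings_bound : 4 <= #|V| ->
  #|colorings e set0 setT| + \sum_a #|colorings e set0 (nbrs e a)|
  <= #|V|.+1 ^ #|V| + #|V|.
Proof.
move=> V4.
have h1 : \sum_a 2 * #|colorings e set0 (nbrs e a)| <=
    \sum_a (collisions e a + multi_collisions e a + 2).
  by apply: leq_sum => a _; exact: into_nbrs_bound.
have h2 : \sum_a (collisions e a + multi_collisions e a) <=
    \sum_(g : {ffun V -> option V}) 2 * ~~ proper_coloring e g.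
  apply: (@leq_trans (\sum_a \sum_(g : {ffun V -> option V})
     proper_coloring e (recolor g a None)
     * (collides_at g a + multi_collides_at g a))).
    by apply: leq_sum => a _; exact: collisions_sum.
  rewrite exchange_big /=; apply: leq_sum => g _; exact: collisions_at_most_2.
have h3 : #|colorings e set0 setT| + \sum_(g : {ffun V -> option V}) ~~ proper_coloring e g
    = #|V|.+1 ^ #|V|.
  rewrite -card_option -card_ffun -[#|{ffun _}|]sum1_card.
  rewrite -sum1_card big_mkcond -big_split /=; apply: eq_bigr => g _.
  have -> : (g \in colorings e set0 setT) = proper_coloring e g.
    apply/coloringsP/proper_coloringP => [[]|h] //; split=> // u; by rewrite inE.
  by case: (proper_coloring e g).
move: h1 h2; rewrite -!big_distrr big_split /= sum_nat_const.
rewrite -h3; set G := \sum_a #|_|; set S := \sum_a _; set P := \sum_g _.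
set X := #|colorings _ _ _|; have -> : #|xpredT : pred V| = #|V| by [].
by move: G S P X #|V| => G S P X m; lia.
Qed.

End Local.

(** * Upper bound: from suffix-free languages to colorings *)

Lemma decP (P : Prop) : reflect P (excluded_middle_informative P).
Proof. by case: excluded_middle_informative => h; constructor. Qed.

Lemma sum_option (T : finType) (F : option T -> nat) :
  \sum_o F o = F None + \sum_a F (Some a).
Proof.
rewrite (bigD1 None) //=; congr (_ + _).
rewrite (reindex_omap Some id) /=; last by case.
by apply: eq_bigl => a; rewrite eqxx.
Qed.

Section UpperBound.
Variables (S : finType) (L : seq S -> Prop) (n : nat) (rep : 'I_n -> seq S).
Variable (state : seq S -> 'I_n).
Hypotheses (n6 : 6 <= n) (S0 : 0 < #|S|) (sfL : suffix_free L).
Hypothesis rep_inj : forall i j, same_quotient L (rep i) (rep j) -> i = j.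
Hypothesis stateP : forall w, same_quotient L w (rep (state w)).

Lemma same_state u v : same_quotient L u v <-> state u = state v.
Proof.
split=> [uv|uv x].
  apply: rep_inj => x; rewrite -(stateP u x) -(stateP v x); exact: uv.
by rewrite (stateP u x) (stateP v x) uv.
Qed.

Lemma state_rep i : state (rep i) = i.
Proof. by apply: rep_inj => x; rewrite -(stateP (rep i) x). Qed.

Lemma state_cat u v w : state u = state v -> state (u ++ w) = state (v ++ w).
Proof.
move/same_state => uv; apply/same_state => x; rewrite -!catA; exact: uv.
Qed.

(** Two powers of a letter [c], with exponents i < j, have the same quotient. A word of [L] starting
    with the i-th power would be a proper suffix of the word of [L] starting with the j-th. *)
Lemma exists_sink : exists w, forall x, ~ L (w ++ x).
Proof.
case/card_gt0P: S0 => c _.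
have : ~~ injectiveb (fun j : 'I_n.+1 => state (nseq j c)).
  by apply/negP => /injectiveP /leq_card; rewrite !card_ord ltnn.
case/injectivePn => i [j ij sij].
wlog lt_ij : i j ij sij / i < j.
  move=> h; case: (ltngtP i j) => [lt|gt|eq]; first exact: (h i j).
    by apply: (h j i) => //; rewrite eq_sym.
  by case/eqP: ij; apply: val_inj.
exists (nseq i c) => x Lx.
have : L (nseq (j - i) c ++ (nseq i c ++ x)).
  rewrite catA -nseqD subnK; last exact: ltnW.
  by move/same_state: sij => /(_ x) [h _]; apply: h.
by move/sfL => /(_ Lx) /(congr1 size) /eqP; rewrite size_nseq subn_eq0 leqNgt lt_ij.
Qed.

Lemma exists_word : exists w, L w.
Proof.
apply: NNPP => h.
have n1 : 1 < n by lia.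
have := @rep_inj (Ordinal (ltnW n1)) (Ordinal n1).
suff e : same_quotient L (rep (Ordinal (ltnW n1))) (rep (Ordinal n1)).
  by move=> /(_ e) /(congr1 val).
by move=> x; split=> Lx; case: h; eexists; exact: Lx.
Qed.

Variable sink : 'I_n.
Hypothesis sinkP : forall w, state w = sink <-> forall x, ~ L (w ++ x).
Let init := state [::].

Lemma init_sink : init != sink.
Proof.
apply/eqP => /sinkP h; have [w Lw] := exists_word; exact: (h w).
Qed.

Lemma state_init w : w <> [::] -> state w != init.
Proof.
move=> w0; apply/eqP => /same_state h; have [x Lx] := exists_word.
by apply: w0; apply: (@sfL w x) => //; apply/h.
Qed.

Definition middle := {i : 'I_n | (i != init) && (i != sink)}.

Lemma card_middle : #|{: middle}| = n - 2.
Proof.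
rewrite card_sig.
have := cardC [pred i : 'I_n | (i != init) && (i != sink)]; rewrite card_ord.
have -> : #|[predC [pred i : 'I_n | (i != init) && (i != sink)]]| = 2.
  have := cards2 init sink; rewrite init_sink => <-.
  by apply: eq_card => i; rewrite !inE negb_and !negbK.
by move=> h; rewrite -[X in _ = X - 2]h addnK; apply: eq_card.
Qed.

(** [None] merges the initial state and the sink; for nonempty [w] it means the sink, by
    [state_init]. *)
Definition mstate (w : seq S) : option middle := insub (state w).

Lemma mstate_some w v : mstate w = Some v -> state w = val v.
Proof. by rewrite /mstate; case: insubP => // u _ <- [->]. Qed.

Lemma mstate_inj w w' : w <> [::] -> w' <> [::] ->
  mstate w = mstate w' -> state w = state w'.
Proof.
move=> /state_init w0 /state_init w0' h.
case hw: (mstate w) => [v|].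
  by rewrite (mstate_some hw); rewrite hw in h; rewrite (mstate_some (esym h)).
move: (hw); rewrite h in hw; move: hw; rewrite /mstate.
case: insubP => //; rewrite w0' /= negbK => /eqP -> _.
by case: insubP => //; rewrite w0 /= negbK => /eqP ->.
Qed.

Definition action (w : seq S) : {ffun middle -> option middle} :=
  [ffun v => mstate (rep (val v) ++ w)].

Lemma rep_middle (v : middle) : rep (val v) <> [::].
Proof.
by move=> h; have /andP [/eqP + _] := valP v; rewrite -{1}(state_rep (val v)) h.
Qed.

Lemma cat_nonempty (u w : seq S) : w <> [::] -> u ++ w <> [::].
Proof. by case: u. Qed.

(** The sink is fixed by every word, so the image of the initial state and the action on the middle
    states determine the whole transformation. *)
Lemma action_synt w w' : w <> [::] -> w' <> [::] ->
  mstate w = mstate w' -> action w = action w' -> synt_equiv L w w'.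
Proof.
move=> w0 w0' hm ha x y.
have sx : state x = state (rep (state x)) by rewrite state_rep.
suff : state (x ++ w) = state (x ++ w').
  by move/same_state => /(_ y); rewrite -!catA.
rewrite (state_cat w sx) (state_cat w' sx).
case: (eqVneq (state x) init) => [xi|xi].
  rewrite xi !(@state_cat (rep init) [::]) ?state_rep //=.
  exact: mstate_inj.
case: (eqVneq (state x) sink) => [xs|xs].
  have dead z : state (rep sink ++ z) = sink.
    apply/sinkP => t; rewrite -catA; move: (z ++ t); apply/sinkP.
    exact: state_rep.
  by rewrite xs !dead.
have xm : (state x != init) && (state x != sink) by rewrite xi xs.
move/ffunP/(_ (Sub (state x) xm)): ha; rewrite !ffunE SubK.
by apply: mstate_inj; apply: cat_nonempty.
Qed.

(** If [x] completed [w ++ u] to a word of [L], prefixing the nonempty [rep (val r)] would give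
    another word of [L], of which the first is a proper suffix. *)
Lemma no_collision w (r : middle) u : w <> [::] ->
  state (w ++ u) = state (rep (val r) ++ (w ++ u)) -> state (w ++ u) = sink.
Proof.
move=> w0 /same_state h; apply/sinkP => x Lx.
apply: (@rep_middle r); apply: (sfL _ Lx); rewrite catA; exact/h.
Qed.

Definition collide (p q : middle) :=
  exists w (r : middle), [/\ w <> [::], mstate w = Some p & action w r = Some q].

Definition collision_rel : rel middle :=
  fun p q => excluded_middle_informative (collide p q \/ collide q p).

Lemma collision_sym : symmetric collision_rel.
Proof. by move=> p q; apply/decP/decP => - [] h; [right|left|right|left]. Qed.

Lemma collide_focus p q u s : collide p q -> action u p = Some s ->
  action u q = Some s -> False.
Proof.
move=> [w [r [w0 hp hq]]]; move: hq; rewrite !ffunE => hq up uq.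
have wu : state (w ++ u) = val s.
  rewrite -(mstate_some up); apply: state_cat.
  by rewrite state_rep (mstate_some hp).
have rwu : state (rep (val r) ++ (w ++ u)) = val s.
  rewrite -(mstate_some uq) catA; apply: state_cat.
  by rewrite state_rep (mstate_some hq).
have := no_collision w0 (etrans wu (esym rwu)); rewrite wu => ss.
by have /andP [_ /eqP] := valP s.
Qed.

Lemma collision_irr : irreflexive collision_rel.
Proof.
move=> p; apply/decP => h; have {h} [w [r [w0 hp]]] : collide p p by case: h.
rewrite ffunE => hq.
have := @no_collision w r [::] w0; rewrite cats0 (mstate_some hp) (mstate_some hq).
by move=> /(_ erefl) ps; have /andP [_ /eqP] := valP p.
Qed.

(** Properness is [collide_focus]. If [w] sends the initial state to [a] and [u] to [c], then [w]
    itself witnesses that [a] and [c] collide. *)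
Lemma action_colorings w : w <> [::] ->
  action w \in colorings collision_rel set0
    (if mstate w is Some a then nbrs collision_rel a else setT).
Proof.
move=> w0; apply/coloringsP; split=> [u v s /decP [] h hu hv|u|u c hu].
- exact: collide_focus h hu hv.
- exact: collide_focus h hv hu.
- by rewrite inE.
case hw: (mstate w) => [a|]; last by rewrite inE.
by rewrite inE; apply/decP; left; exists w, u.
Qed.

Lemma complexity_bound k : syntactic_complexity L k ->
  k <= (n - 1) ^ (n - 2) + n - 2.
Proof.
move=> [f [f0 [f_inj _]]].
pose X (o : option middle) := colorings collision_rel set0
    (if o is Some a then nbrs collision_rel a else setT).
pose T := [set og : option middle * {ffun middle -> option middle} | og.2 \in X og.1].
pose key i := (mstate (f i), action (f i)).
have key_inj : injective key.
  by move=> i j [hm ha]; apply: f_inj; apply: action_synt.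
have kT : k <= #|T|.
  rewrite -(card_ord k) -cardsT -(card_imset _ key_inj).
  apply: subset_leq_card; apply/subsetP => _ /imsetP [i _ ->].
  by rewrite inE; exact: action_colorings.
apply: (leq_trans kT).
have -> : #|T| = \sum_o #|X o|.
  rewrite -sum1dep_card.
  rewrite -(pair_big_dep xpredT (fun o g => g \in X o) (fun _ _ => 1)) /=.
  by apply: eq_bigr => o _; rewrite sum1_card.
rewrite sum_option /=.
have := colorings_bound collision_sym collision_irr; rewrite card_middle.
have -> : (n - 2).+1 = n - 1 by lia.
move=> /(_ ltac:(lia)) h; apply: leq_trans h _; lia.
Qed.

End UpperBound.

Lemma upper_bound (n : nat) (S : finType) (L : seq S -> Prop) :
  6 <= n -> 0 < #|S| -> suffix_free L -> num_quotients L n ->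
  forall k, syntactic_complexity L k -> k <= (n - 1) ^ (n - 2) + n - 2.
Proof.
move=> n6 S0 sfL [rep [_ [rep_inj rep_cover]]] k.
pose pick w := constructive_indefinite_description _ (rep_cover w I).
pose state w := proj1_sig (pick w).
have stateP w : same_quotient L w (rep (state w)) := proj2_sig (pick w).
have [w0 w0P] := exists_sink S0 sfL rep_inj stateP.
have sinkP w : state w = state w0 <-> forall x, ~ L (w ++ x).
  split=> [/(same_state rep_inj stateP) h x /h|h]; first exact: w0P.
  by apply/(same_state rep_inj stateP) => x; split=> [/h|/w0P].
exact: (complexity_bound n6 S0 sfL rep_inj stateP sinkP).
Qed.

(** * A language attaining the bound *)

Section Witness.
Variable m' : nat.
Let M := 'I_m'.+1.

(** One letter for each transformation of the extremal semigroup, so that the number of letters is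
    the complexity. *)
Definition letter : finType := ({ffun M -> option M} + M)%type.

(* [None] is the initial state and [Some None] the sink. *)
Definition wstep (q : option (option M)) (s : letter) : option (option M) :=
  Some (match q, s with
        | None, inr a => Some a
        | Some o, inl f => obind f o
        | _, _ => None
        end).

Definition wrun := foldl wstep.

Definition wlang (w : seq letter) : Prop := wrun None w = Some (Some ord0).

Definition blank_letter : letter := inl [ffun=> None].

Lemma wrun_cat q u v : wrun q (u ++ v) = wrun (wrun q u) v.
Proof. exact: foldl_cat. Qed.

Lemma wrun_sink w : wrun (Some None) w = Some None.
Proof. by elim: w => [|[f|a] w IH]. Qed.

Lemma wrun_some q w : w <> [::] -> exists o, wrun q w = Some o.
Proof.
case/lastP: w => // w s _; rewrite -cats1 wrun_cat.
by eexists.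
Qed.

(** A word of the language starts with some [inr a], and this letter sends every state except the
    initial one to the sink; no nonempty word leads back to the initial state. *)
Lemma wlang_suffix_free : suffix_free wlang.
Proof.
move=> v u; rewrite /wlang wrun_cat => vu Lu.
case: v vu => // s v vu; have [o ho] := @wrun_some None (s :: v) ltac:(done).
move: vu; rewrite ho; case: u Lu => // [[f|a] u] /=; first by rewrite wrun_sink.
by rewrite wrun_sink.
Qed.

Definition wrep (q : option (option M)) : seq letter :=
  match q with
  | None => [::]
  | Some None => [:: blank_letter]
  | Some (Some a) => [:: inr a]
  end.

Lemma wrun_rep q : wrun None (wrep q) = q.
Proof. by case: q => [[a|]|]. Qed.

Lemma wrun_separate q q' :
  (forall x, wrun q x = Some (Some ord0) <-> wrun q' x = Some (Some ord0)) ->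
  q = q'.
Proof.
(* By symmetry [q] is initial, or [q] is a middle state and [q'] is not initial; then a single
   letter accepts from [q] only. *)
wlog hq : q q' / match q, q' with
    | None, Some _ => True | Some (Some _), Some _ => True | _, _ => False end.
  move=> h hqq; have hqq' x := iff_sym (hqq x).
  case: q q' hqq hqq' => [[a|]|] [[b|]|] hqq hqq' //.
  - exact: h.
  - exact: h.
  - by apply/esym/h.
  - by apply/esym/h.
  - by apply/esym/h.
  - exact: h.
  - exact: h.
case: q q' hq => [[a|]|] [o|] // _ h.
  have := h [:: inl [ffun b => if b == a then Some ord0 else None]].
  rewrite /= /wstep /= ffunE eqxx => - [/(_ erefl)].
  by case: o {h} => [b|] //=; rewrite ffunE; case: eqP => // ->.
by have [/(_ erefl)] := h [:: inr ord0].
Qed.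

Lemma wlang_quotient u v :
  same_quotient wlang u v <-> wrun None u = wrun None v.
Proof.
split=> [h|h x]; last by rewrite /wlang !wrun_cat h.
by apply: wrun_separate => x; move: (h x); rewrite /wlang !wrun_cat.
Qed.

(** After any first letter the state is no longer initial, so a second letter [inr _] leads to the
    sink from everywhere, as [blank_letter] does. *)
Definition wcomp (s s' : letter) : letter :=
  match s, s' with
  | inl f, inl g => inl [ffun a => obind g (f a)]
  | inr a, inl g => if g a is Some b then inr b else blank_letter
  | _, inr _ => blank_letter
  end.

Lemma wstep_comp q s s' : wstep (wstep q s) s' = wstep q (wcomp s s').
Proof.
case: q s s' => [[a|]|] [f|b] [g|c] //=; rewrite /wstep /= ?ffunE //.
- by case: (g b) => //=; rewrite ffunE.
- by case: (g b).
- by case: (g b).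
Qed.

Lemma wrun_letter w : w <> [::] -> exists s, forall q, wrun q w = wstep q s.
Proof.
elim: w => // s w IH _; case: w IH => [_|s' w IH]; first by exists s.
have [t ht] := IH ltac:(done); exists (wcomp s t) => q.
by rewrite -wstep_comp -ht.
Qed.

Lemma wstep_inj s s' : (forall q, wstep q s = wstep q s') -> s = s'.
Proof.
case: s s' => [f|a] [g|b] h.
- congr inl; apply/ffunP => a; by have [] := h (Some (Some a)).
- by have := h None.
- by have := h None.
- by have [->] := h None.
Qed.

Lemma wlang_synt u v :
  synt_equiv wlang u v <-> forall q, wrun q u = wrun q v.
Proof.
split=> [h q|h x y]; last by rewrite /wlang !wrun_cat h.
apply: wrun_separate => y; move: (h (wrep q) y).
by rewrite /wlang !wrun_cat wrun_rep.
Qed.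

End Witness.

Lemma nclasses_finType (I : finType) (T : Type) (P : T -> Prop)
    (R : T -> T -> Prop) (f : I -> T) :
  (forall i, P (f i)) -> (forall i j, R (f i) (f j) -> i = j) ->
  (forall x, P x -> exists i, R x (f i)) -> nclasses P R #|I|.
Proof.
move=> fP f_inj f_cover; exists (fun i => f (enum_val i)); split=> //.
split=> [i j /f_inj /enum_val_inj //|x /f_cover [i xi]].
by exists (enum_rank i); rewrite enum_rankK.
Qed.

Lemma witness_quotients m' : num_quotients (@wlang m') m'.+3.
Proof.
have -> : m'.+3 = #|{: option (option 'I_m'.+1)}| by rewrite !card_option card_ord.
apply: (@nclasses_finType _ _ _ _ (@wrep m')) => // [q q'|w _].
  by move/wlang_quotient; rewrite !wrun_rep.
by exists (wrun None w); apply/wlang_quotient; rewrite wrun_rep.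
Qed.

Lemma witness_complexity m' :
  syntactic_complexity (@wlang m') (m'.+2 ^ m'.+1 + m'.+1).
Proof.
have -> : m'.+2 ^ m'.+1 + m'.+1 = #|letter m'|.
  by rewrite card_sum card_ffun card_option !card_ord.
apply: (@nclasses_finType _ _ _ _ (fun s : letter m' => [:: s])) => // [s s'|w w0].
  by move/wlang_synt => h; exact: wstep_inj.
have [s hs] := wrun_letter w0; exists s; apply/wlang_synt => q.
exact: hs.
Qed.

Theorem theorem1 (n : nat) (hn : 6 <= n) :
  (forall (S : finType) (L : seq S -> Prop),
      0 < #|S| -> suffix_free L -> num_quotients L n ->
      forall k, syntactic_complexity L k -> k <= (n - 1) ^ (n - 2) + n - 2)
  /\
  (exists (S : finType) (L : seq S -> Prop),
      [/\ 0 < #|S|, suffix_free L, num_quotients L n &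
          syntactic_complexity L ((n - 1) ^ (n - 2) + n - 2)]).
Proof.
split=> [S L S0 sfL nq k|]; first exact: upper_bound.
case: n hn => [|[|[|m']]] // _; exists (letter m'), (@wlang m'); split.
- by apply/card_gt0P; exists (blank_letter m').
- exact: wlang_suffix_free.
- exact: witness_quotients.
- have -> : (m'.+3 - 1) ^ (m'.+3 - 2) + m'.+3 - 2 = m'.+2 ^ m'.+1 + m'.+1.
    by rewrite -addnBA // subn1 subn2.
  exact: witness_complexity.
Qed.
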